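(* Let $\mathbb X$ and $\mathbb Y$ be minimal, aperiodic flow spaces with expansions $(X_i,f_i,p_i)$ and $(Y_i,g_i,q_i)$ in which every $X_i$ and every $Y_i$ is a copy of the same oriented wedge $W_n$ of $n$ circles, so that each $\pi_1(f_i)$ and $\pi_1(g_i)$ is an endomorphism of the free group $F_n=\pi_1(W_n)$. Suppose that $\pi_1(f_i)$ is an automorphism of $F_n$ for every $i$, and that for every $i$ there is $j>i$ such that $\pi_1(g_j)$ is not an automorphism. Then $\mathbb X$ and $\mathbb Y$ are not flow equivalent.
   Context: Flow space: compact metrizable space of topological dimension one with continuous $\mathbb R$-action without fixed points; minimal: all orbits dense; aperiodic: no periodic orbit; flow equivalence: homeomorphism mapping orbits to orbits preserving flow orientation. Expansion of $\mathbb X$ about a point $x_\bullet$: oriented wedges of circles $X_i$ with wedge points $x_i$, positive maps $f_i\colon X_{i+1}\to X_i$ (continuous surjections, wedge point to wedge point, orientation preserving on each circle, locally injective away from the wedge point), projections $p_i\colon\mathbb X\to X_i$ (continuous surjections, locally injective and orientation preserving along orbits) with $p_i(x_\bullet)=x_i$, $p_n=f_n\circ\cdots\circ f_{m-1}\circ p_m$, and $x\mapsto(p_i(x))_i$ a homeomorphism onto $\varprojlim(X_i,f_i)$. *)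

(* Defs.v *)
From HB Require Import structures.
From mathcomp Require Import all_boot all_order all_algebra.
From mathcomp Require Import all_classical all_reals all_analysis.
Unset Printing Implicit Defensive.
Import Order.TTheory GRing.Theory Num.Theory.
Import numFieldNormedType.Exports.
Local Open Scope classical_set_scope.
Local Open Scope ring_scope.

(* The oriented wedge W_n of n circles, realised concretely in the     *)
(* plane R*R: circle k has centre (r_k,0) and radius r_k = 1/(k+1);    *)
(* these circles pairwise meet only at the origin (the wedge point).   *)
(* gam k : R -> R*R is the 1-periodic positively oriented              *)
(* parametrisation of circle k, with gam k 0 = wedge point.            *)

Definition wrad {R : realType} {n : nat} (k : 'I_n) : R := (k.+1%:R)^-1.

Definition gam {R : realType} {n : nat} (k : 'I_n) (t : R) : R * R :=
  (wrad k - wrad k * cos (pi *+ 2 * t), wrad k * sin (pi *+ 2 * t)).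

Definition wedgeW {R : realType} (n : nat) : set (R * R) :=
  [set z | exists (k : 'I_n) (t : R), z = gam k t].

Definition wpt {R : realType} : R * R := (0, 0).

Definition incr_on {R : realType} (A : set R) (h : R -> R) : Prop :=
  forall a b, A a -> A b -> a < b -> h a < h b.

(* al : R -> R*R (a path into W_n) is locally injective and orientation
   preserving at time t: just before t it runs positively along some
   circle m, just after t it runs positively along some circle m'. *)
Definition pos_local {R : realType} (n : nat) (al : R -> R * R) (t : R) : Prop :=
  exists e : R, 0 < e /\
  exists (m m' : 'I_n) (h h' : R -> R),
    {within [set s | t - e < s <= t], continuous h} /\
    incr_on [set s | t - e < s <= t] h /\
    (forall s, t - e < s <= t -> al s = gam m (h s)) /\
    {within [set s | t <= s < t + e], continuous h'} /\
    incr_on [set s | t <= s < t + e] h' /\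
    (forall s, t <= s < t + e -> al s = gam m' (h' s)).

Definition positive_map {R : realType} (n : nat) (f : R * R -> R * R) : Prop :=
  {within wedgeW n, continuous f} /\
  f @` wedgeW n = wedgeW n /\
  f wpt = wpt /\
  (forall (k : 'I_n) (t : R), 0 < t < 1 -> pos_local n (fun u => f (gam k u)) t).

(* The loop al : [0,1] -> W_n traces the positive word w: [0,1] splits
   into size w consecutive intervals, on the j-th of which al runs once
   positively around circle w_j (from wedge point to wedge point). *)
Definition traces {R : realType} (n : nat) (al : R -> R * R) (w : seq 'I_n) : Prop :=
  exists s : nat -> R, s 0%N = 0 /\ s (size w) = 1 /\
  forall (j : nat) (Hj : (j < size w)%N), s j < s j.+1 /\
    exists h : R -> R,
      {within [set u | s j <= u <= s j.+1], continuous h} /\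
      incr_on [set u | s j <= u <= s j.+1] h /\
      h (s j) = 0 /\ h (s j.+1) = 1 /\
      (forall u, s j <= u <= s j.+1 ->
         al u = gam (tnth (in_tuple w) (Ordinal Hj)) (h u)).

(* pi1(f) : F_n -> F_n sends the generator a_k (class of loop gam k) to
   the positive word w k, i.e. the loop f o gam k traces w k. *)
Definition pi1_is {R : realType} (n : nat) (f : R * R -> R * R)
  (w : 'I_n -> seq 'I_n) : Prop :=
  forall k : 'I_n, traces n (fun u => f (gam k u)) (w k).

(* a letter (k, b): generator a_k if b = false, its inverse if b = true *)
Definition letter (n : nat) := ('I_n * bool)%type.
Definition linv {n : nat} (x : letter n) : letter n := (x.1, ~~ x.2).
Definition wpush {n : nat} (x : letter n) (s : seq (letter n)) : seq (letter n) :=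
  if s is y :: s' then (if y == linv x then s' else x :: s) else [:: x].
Definition freduce {n : nat} (w : seq (letter n)) : seq (letter n) :=
  foldr (@wpush n) [::] w.
(* elements of F_n = reduced words *)
Definition reducedw {n : nat} (w : seq (letter n)) : bool := freduce w == w.
Definition winv {n : nat} (w : seq (letter n)) : seq (letter n) := rev (map linv w).
Definition fg_endo {n : nat} (phi : 'I_n -> seq (letter n)) (w : seq (letter n))
  : seq (letter n) :=
  freduce (flatten (map (fun x => if x.2 then winv (phi x.1) else phi x.1) w)).
Definition is_aut {n : nat} (phi : 'I_n -> seq (letter n)) : Prop :=
  {in reducedw &, injective (fg_endo phi)} /\
  (forall u, reducedw u -> exists w, reducedw w /\ fg_endo phi w = u).
Definition posw {n : nat} (w : 'I_n -> seq 'I_n) : 'I_n -> seq (letter n) :=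
  fun k => map (fun m => (m, false)) (w k).

Definition is_flow {R : realType} {T : topologicalType} (phi : R -> T -> T) : Prop :=
  continuous (fun z : R * T => phi z.1 z.2) /\
  (forall x, phi 0 x = x) /\
  (forall s t x, phi (s + t) x = phi s (phi t x)).

Definition covdim_le (T : topologicalType) (m : nat) : Prop :=
  forall (k : nat) (U : 'I_k -> set T),
    (forall i, open (U i)) -> (forall x, exists i, U i x) ->
    exists (l : nat) (V : 'I_l -> set T),
      (forall j, open (V j)) /\ (forall x, exists j, V j x) /\
      (forall j, exists i, V j `<=` U i) /\
      (forall x, (#|[pred j : 'I_l | `[< V j x >]]| <= m.+1)%N).

Definition topdim_one (T : topologicalType) : Prop :=
  covdim_le T 1 /\ ~ covdim_le T 0.

(* flow space (the metric of T witnesses metrizability) *)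
Definition flow_space {R : realType} {T : pseudoMetricType R} (phi : R -> T -> T) : Prop :=
  compact [set: T] /\ hausdorff_space T /\ topdim_one T /\ is_flow phi /\
  (forall x, exists t, phi t x <> x).

Definition orbit {R : realType} {T : topologicalType} (phi : R -> T -> T) (x : T) : set T :=
  range (fun t => phi t x).

Definition minimal_flow {R : realType} {T : topologicalType} (phi : R -> T -> T) : Prop :=
  forall x, closure (orbit phi x) = [set: T].

Definition aperiodic_flow {R : realType} {T : topologicalType} (phi : R -> T -> T) : Prop :=
  forall x t, phi t x = x -> t = 0.

Definition invlim {R : realType} (n : nat) (f : nat -> R * R -> R * R) : set {ptws nat -> (R * R)%type} :=
  [set y | (forall i, wedgeW n (y i)) /\ (forall i, y i = f i (y i.+1))].

Definition expansion {R : realType} (n : nat) {T : topologicalType} (phi : R -> T -> T)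
  (x0 : T) (f : nat -> R * R -> R * R) (p : nat -> T -> R * R) : Prop :=
  (forall i, positive_map n (f i)) /\
  (forall i, continuous (p i) /\ range (p i) = wedgeW n /\
     (forall x t, pos_local n (fun u => p i (phi u x)) t) /\ p i x0 = wpt) /\
  (forall i x, p i x = f i (p i.+1 x)) /\
  (let P : T -> {ptws nat -> (R * R)%type} := fun x i => p i x in
   continuous P /\ injective P /\ range P = invlim n f /\
   exists Q : {ptws nat -> (R * R)%type} -> T, {within invlim n f, continuous Q} /\
     (forall x, Q (P x) = x)).

Definition flow_equiv {R : realType} {T1 T2 : topologicalType}
  (phi : R -> T1 -> T1) (psi : R -> T2 -> T2) : Prop :=
  exists (h : T1 -> T2) (g : T2 -> T1),
    continuous h /\ continuous g /\ cancel h g /\ cancel g h /\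
    exists tau : T1 -> R -> R, forall x,
      incr_on setT (tau x) /\ (forall v, exists t, tau x t = v) /\
      (forall t, h (phi t x) = psi (tau x t) (h x)).

(* Main.v *)
(* Call a G-valued function c on pairs of close points flat when c x y * c y z = c x z
   for mutually close x, y, z. Up to coboundaries, the flat cocycles on the wedge W_n
   are classified by their holonomy along the n circles, i.e. by the homomorphisms
   F_n -> G up to conjugacy; and on a compact inverse limit of wedges every flat
   cocycle is a pullback from each far enough stage, because the fibres of the
   projections become small.

   A flow equivalence is in particular a homeomorphism, so both towers may be read on
   one compact space. Expressing the tautological F_n-cocycle of the stage X_0
   through a far stage Y_j yields an endomorphism a of F_n, and going on to a far
   stage X_k gives a \o b = pi_1(X_k -> X_0) up to conjugacy for some b. As the right-hand
   side is onto, so is a, and a is an automorphism because F_n is Hopfian (being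
   residually finite). The endomorphism obtained at Y_(j+1) is a \o pi_1(g_j), hence
   pi_1(g_j) is an automorphism for all large j. *)

Require Import Defs.
From HB Require Import structures.
From mathcomp Require Import all_boot all_order all_fingroup all_algebra.
From mathcomp Require Import all_classical all_reals all_analysis.
From mathcomp Require Import ring lra.
Import Order.TTheory GRing.Theory Num.Theory.
Import numFieldNormedType.Exports.

(** * Free groups *)

Section Words.
Context {n : nat}.
Implicit Types (x y : letter n) (s u v w : seq (letter n)).
Local Open Scope nat_scope.

Lemma linvK : involutive (@linv n).
Proof. by case=> k b; rewrite /linv /= negbK. Qed.

(** Sortedness for this relation is reducedness in local form: no letter is followed by its inverse.
    Inductions on words run on this form instead of the fixed-point equation behind [reducedw]. *)
Definition noncancel : rel (letter n) := fun x y => y != linv x.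

Lemma wpush_sorted x s : sorted noncancel s -> sorted noncancel (wpush x s).
Proof.
case: s => [|y s] //=; case: ifP => [_|/negbT nc] /=; last by move=> ->; rewrite andbT.
exact: path_sorted.
Qed.

Lemma freduce_sorted w : sorted noncancel (freduce w).
Proof. by elim: w => //= x w; exact: wpush_sorted. Qed.

Lemma sorted_freduce w : sorted noncancel w -> freduce w = w.
Proof.
elim: w => //= x w IHw xw; rewrite IHw ?(path_sorted xw)//.
by case: w xw {IHw} => //= y w /andP[/negbTE ->].
Qed.

Lemma freduce_id w : freduce (freduce w) = freduce w.
Proof. exact/sorted_freduce/freduce_sorted. Qed.

Lemma reducedwP w : reducedw w = sorted noncancel w.
Proof.
by apply/eqP/idP => [<-|/sorted_freduce//]; exact: freduce_sorted.
Qed.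

(** On reduced words, pushing a letter and pushing its inverse undo each other, so the generators
    act by bijections on reduced words. This is van der Waerden's route to associativity: it makes
    reduction compatible with concatenation. *)
Lemma wpushK x s : sorted noncancel s -> wpush x (wpush (linv x) s) = s.
Proof.
case: s => [|y s] /=; first by rewrite eqxx.
rewrite linvK; have [->|yx] := eqVneq y x; last by rewrite /= eqxx.
by case: s => //= z s /andP[/negbTE ->].
Qed.

Lemma freduce_cat u v : freduce (u ++ v) = foldr wpush (freduce v) u.
Proof. by rewrite /freduce foldr_cat. Qed.

Lemma freduce_catr u v : freduce (u ++ freduce v) = freduce (u ++ v).
Proof. by rewrite !freduce_cat freduce_id. Qed.

Lemma freduce_wpush x u v : freduce (wpush x u ++ v) = freduce (x :: u ++ v).
Proof.
case: u => [|y u] //=; case: eqP => // ->.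
by rewrite /= wpushK// freduce_sorted.
Qed.

Lemma freduce_catl u v : freduce (freduce u ++ v) = freduce (u ++ v).
Proof.
by elim: u => //= x u IHu; rewrite freduce_wpush/= IHu.
Qed.

Lemma winv_cons x u : winv (x :: u) = rcons (winv u) (linv x).
Proof. by rewrite /winv /= rev_cons. Qed.

Lemma freduce_winvl u : freduce (winv u ++ u) = [::].
Proof.
elim: u => //= x u IHu; rewrite winv_cons cat_rcons freduce_cat/=.
by rewrite -[X in wpush X (wpush _ _)]/(linv x) -{2}[x]linvK wpushK ?freduce_sorted// -freduce_cat.
Qed.

Lemma winvK : involutive (@winv n).
Proof.
by move=> u; rewrite /winv map_rev revK -map_comp map_id_in// => x _; rewrite /= linvK.
Qed.

Lemma freduce_winvr u : freduce (u ++ winv u) = [::].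
Proof. by rewrite -{1}[u]winvK freduce_winvl. Qed.

End Words.

Record free_group (n : nat) := FreeGroup
  { fgval :> seq (letter n) ; fgvalP : reducedw fgval }.
Arguments FreeGroup {n}.
Arguments fgval {n} _.
Arguments fgvalP {n} _.

HB.instance Definition _ n := [isSub for @fgval n].
HB.instance Definition _ n := [Choice of free_group n by <:].

Section FreeGroup.
Context {n : nat}.
Implicit Types x y z : free_group n.

Definition fgof (w : seq (letter n)) : free_group n :=
  FreeGroup (freduce w) (introT eqP (freduce_id w)).

Lemma fgof_eq u v : freduce u = freduce v -> fgof u = fgof v.
Proof. by move=> uv; apply: val_inj. Qed.

Lemma fgvalK : cancel (@fgval n) fgof.
Proof. by case=> w rw; apply: val_inj; apply/eqP. Qed.

Definition fgmul x y := fgof (x ++ y).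
Definition fginv x := fgof (winv x).
Definition fgone := fgof [::].

Lemma fgmulA : associative fgmul.
Proof.
by move=> x y z; apply: fgof_eq; rewrite /= freduce_catl freduce_catr catA.
Qed.

Lemma fgmul1 : left_id fgone fgmul.
Proof. by move=> x; rewrite -[RHS]fgvalK. Qed.

Lemma fgmulr1 : right_id fgone fgmul.
Proof. by move=> x; rewrite -[RHS]fgvalK /fgmul cats0. Qed.

Lemma fgmulV : left_inverse fgone fginv fgmul.
Proof. by move=> x; apply: fgof_eq; rewrite freduce_catl freduce_winvl. Qed.

Lemma fgmulrV : right_inverse fgone fginv fgmul.
Proof. by move=> x; apply: fgof_eq; rewrite freduce_catr freduce_winvr. Qed.

HB.instance Definition _ := isGroup.Build (free_group n) fgmulA fgmul1 fgmulr1
   fgmulV fgmulrV.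

End FreeGroup.

Local Open Scope group_scope.

(** * Homomorphisms out of a free group *)

Section WordEval.
Context {n : nat} {G : groupType}.
Implicit Types (al be : 'I_n -> G) (w : seq (letter n)) (x y : free_group n).

(** The homomorphism from F_n extending [al], taken on arbitrary words so that concatenation can be
    used before any reduction. *)
Definition word_eval al w : G :=
  \prod_(l <- w) (if l.2 then (al l.1)^-1 else al l.1).

Lemma word_eval_nil al : word_eval al [::] = 1.
Proof. exact: big_nil. Qed.

Lemma word_eval_cons al l w :
  word_eval al (l :: w) = (if l.2 then (al l.1)^-1 else al l.1) * word_eval al w.
Proof. exact: big_cons. Qed.

Lemma word_eval_cat al u v :
  word_eval al (u ++ v) = word_eval al u * word_eval al v.
Proof. exact: big_cat. Qed.

Lemma word_eval_wpush al l w : word_eval al (wpush l w) = word_eval al (l :: w).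
Proof.
case: w => //= y w; case: eqP => // ->; rewrite !word_eval_cons /=.
by case: l => k [] /=; rewrite ?mulVKg ?mulKg.
Qed.

Lemma word_eval_freduce al w : word_eval al (freduce w) = word_eval al w.
Proof.
by elim: w => //= l w IHw; rewrite word_eval_wpush !word_eval_cons IHw.
Qed.

Lemma word_eval_winv al w : word_eval al (winv w) = (word_eval al w)^-1.
Proof.
apply/(mulIg (word_eval al w)); rewrite mulVg -word_eval_cat.
by rewrite -word_eval_freduce freduce_winvl word_eval_nil.
Qed.

Lemma word_evalM al x y : word_eval al (x * y) = word_eval al x * word_eval al y.
Proof. by rewrite [LHS]word_eval_freduce word_eval_cat. Qed.

Lemma word_eval1 al : word_eval al (1 : free_group n) = 1.
Proof. exact: word_eval_nil. Qed.

Lemma word_evalV al x : word_eval al x^-1 = (word_eval al x)^-1.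
Proof. by rewrite [LHS]word_eval_freduce word_eval_winv. Qed.

Lemma eq_word_eval al be w : al =1 be -> word_eval al w = word_eval be w.
Proof. by move=> eq_ab; apply: eq_bigr => x _; rewrite eq_ab. Qed.

Lemma word_evalJ al (u : G) w :
  word_eval (fun k => al k ^ u) w = word_eval al w ^ u.
Proof.
elim: w => [|[k b] w IHw]; first by rewrite !word_eval_nil conj1g.
by rewrite !word_eval_cons conjMg IHw; case: b; rewrite //= conjVg.
Qed.

End WordEval.

Lemma word_eval_comp {n m : nat} {G : groupType} (al : 'I_m -> G)
    (ga : 'I_n -> free_group m) (w : seq (letter n)) :
  word_eval (fun k => word_eval al (ga k)) w = word_eval al (word_eval ga w).
Proof.
elim: w => [|[k b] w IHw]; first by rewrite !word_eval_nil.
by rewrite !word_eval_cons word_evalM IHw; case: b; rewrite //= word_evalV.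
Qed.

Lemma inj_surj_bij (T : choiceType) (U : eqType) (f : T -> U) :
  injective f -> (forall y, exists x, f x = y) -> bijective f.
Proof.
move=> inj sur; have sur' y : exists x, f x == y by have [x <-] := sur y; exists x.
exists (fun y => xchoose (sur' y)) => [x|y]; last exact/eqP/(xchooseP (sur' y)).
exact/inj/eqP/(xchooseP (sur' _)).
Qed.

Section FreeGroupEndomorphisms.
Context {n : nat}.
Implicit Types (al be : 'I_n -> free_group n) (x : free_group n).

Definition fggen (k : 'I_n) : free_group n := fgof [:: (k, false)].

Definition fghom al x : free_group n := word_eval al x.

Lemma word_eval_fggen (G : groupType) (al : 'I_n -> G) k : word_eval al (fggen k) = al k.
Proof. by rewrite word_eval_cons word_eval_nil mulg1. Qed.

Lemma word_eval_gen w : word_eval fggen w = fgof w.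
Proof.
elim: w => [|[k b] w IHw]; first by rewrite word_eval_nil.
rewrite word_eval_cons IHw; case: b; apply: fgof_eq => /=.
  by rewrite freduce_id.
by rewrite freduce_id.
Qed.

Lemma fgof_cat (u v : seq (letter n)) : fgof (u ++ v) = fgof u * fgof v.
Proof. by rewrite -!word_eval_gen word_eval_cat. Qed.

Lemma fghom_gen : fghom fggen =1 id.
Proof. by move=> x; rewrite /fghom word_eval_gen fgvalK. Qed.

Lemma fghom_comp al be : fghom al \o fghom be =1 fghom (fghom al \o be).
Proof. by move=> x; exact/esym/word_eval_comp. Qed.

Lemma fg_endoE (ph : 'I_n -> seq (letter n)) w :
  fg_endo ph w = word_eval (fun k => fgof (ph k)) w.
Proof.
rewrite /fg_endo -[LHS]/(fgval (fgof _)); congr fgval.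
elim: w => [|[k b] w IHw]; first by rewrite word_eval_nil.
rewrite word_eval_cons -IHw /= fgof_cat; case: b => //=.
by rewrite -!word_eval_gen word_eval_winv.
Qed.

(** Passes from injectivity and surjectivity on raw reduced words to bijectivity of a self-map of
    [free_group n], where maps can be composed and inverted. *)
Lemma is_autP (ph : 'I_n -> seq (letter n)) :
  is_aut ph <-> bijective (fghom (fun k => fgof (ph k))).
Proof.
split=> [[inj_ph sur_ph]|[psi phK psiK]].
  apply: inj_surj_bij.
    move=> [u ru] [v rv] /(congr1 fgval); rewrite -!fg_endoE => /inj_ph uv.
    by apply: val_inj; apply: uv.
  move=> y; have [w [rw wy]] := sur_ph y (fgvalP y).
  by exists (FreeGroup w rw); apply: val_inj; rewrite /= -fg_endoE.
split=> [u v ru rv uv|u ru].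
  suff: FreeGroup u ru = FreeGroup v rv by case.
  by apply: (can_inj phK); apply: val_inj; rewrite /= -!fg_endoE.
exists (psi (FreeGroup u ru)); split; first exact: fgvalP.
by rewrite fg_endoE -[word_eval _ _]/(fghom _ (psi _)) psiK.
Qed.

End FreeGroupEndomorphisms.

(** * Residual finiteness and the Hopf property *)

Lemma perm_extend (T : finType) (D : {set T}) (f : T -> T) :
  {in D &, injective f} -> exists s : {perm T}, {in D, s =1 f}.
Proof.
(* The complements of [D] and of its image have equal size, so the extension can match their
   enumerations. *)
move=> injf; set A := enum (~: D); set B := enum (~: (f @: D)).
have sAB : size A = size B.
  by rewrite -!cardE [LHS]cardsCs [RHS]cardsCs !finset.setCK card_in_imset.
pose h x := if x \in D then f x else nth x B (index x A).
have memA x : (x \in A) = (x \notin D) by rewrite mem_enum inE.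
have iB x : x \notin D -> (index x A < size B)%N by rewrite -sAB index_mem memA.
have hB x : x \notin D -> nth x B (index x A) \notin f @: D.
  by move=> /iB/(mem_nth x); rewrite mem_enum inE.
have injh : injective h.
  move=> x y; rewrite /h; case: ifPn => xD; case: ifPn => yD.
  - exact: injf.
  - by move=> fx; have:= hB _ yD; rewrite -fx imset_f.
  - by move=> fy; have:= hB _ xD; rewrite fy imset_f.
  rewrite (set_nth_default y) ?iB// => /eqP; rewrite nth_uniq ?iB ?enum_uniq//.
  move=> /eqP ixy; rewrite -[x](@nth_index _ x x A) ?memA// ixy.
  by rewrite (set_nth_default y) ?sAB ?iB// nth_index ?memA.
by exists (perm injh) => x xD; rewrite permE /h xD.
Qed.

(* The i-th letter of w is to move the point i to i.+1; reducedness makes the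
   prescribed partial maps injective, so that they extend to permutations. *)
Lemma free_group_residually_finite n (w : free_group n) : w != 1 ->
  exists m (rho : 'I_n -> 'S_m), word_eval rho w != 1.
Proof.
case: w => w rw w1; have : w != [::] by apply: contraNneq w1 => w0; apply/eqP/val_inj.
move=> w0 {w1}; have srt : sorted noncancel w by rewrite -reducedwP.
set L := size w; rewrite /=.
have x0 : letter n by case: w w0 {L srt rw} => // x.
have L0 : (0 < L)%N by rewrite lt0n size_eq0.
pose fwd k (i : 'I_L.+1) := (i < L)%N && (nth x0 w i == (k, false)).
pose bwd k (i : 'I_L.+1) := (0 < i)%N && (nth x0 w i.-1 == (k, true)).
pose D k := [set i | fwd k i || bwd k i].
pose st k (i : 'I_L.+1) : 'I_L.+1 := if fwd k i then inord i.+1 else inord i.-1.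
have nc i : (i.+1 < L)%N -> nth x0 w i.+1 != linv (nth x0 w i).
  move=> iL; have /(sortedP x0)/(_ i iL) := srt; exact.
(* A common target of a forward move from [i] and a backward move from [j] would make the letters
   [i] and [i.+1] of [w] cancel. *)
have fb k (i j : 'I_L.+1) : fwd k i -> bwd k j -> i.+1 != j.-1.
  move=> /andP[iL /eqP wi] /andP[j0 /eqP wj]; apply/eqP => ij.
  have iL1 : (i.+1 < L)%N by rewrite ij prednK// -ltnS ltn_ord.
  by have := nc i iL1; rewrite ij wi wj eqxx.
have stP k : {in D k &, injective (st k)}.
  move=> i j; rewrite !inE /st => iD jD.
  have v (l : 'I_L.+1) : val (inord l.-1 : 'I_L.+1) = l.-1.
    by rewrite /= inordK// (leq_ltn_trans (leq_pred _)).
  case: ifPn iD jD => [fi _|nfi /= bi]; case: ifPn => [fj _|nfj /= bj] /(congr1 val);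
    rewrite ?v /= ?inordK ?ltnS ?(andP fi).1 ?(andP fj).1//.
  - by move=> [ij]; apply: val_inj.
  - by move/eqP; rewrite (negbTE (fb _ _ _ fi bj)).
  - by move/esym/eqP; rewrite (negbTE (fb _ _ _ fj bi)).
  move=> ij; apply: val_inj => /=.
  by rewrite -[LHS]prednK ?(andP bi).1// ij prednK ?(andP bj).1.
have [rho rhoP] : {rho : 'I_n -> 'S_L.+1 & forall k, {in D k, rho k =1 st k}}.
  by apply: (@choice 'I_n 'S_L.+1 (fun k s => {in D k, s =1 st k})) => k; apply: perm_extend.
exists L.+1, rho; apply/eqP => ev1.
(* Permutations compose from left to right, so the prefix of length [i] carries the point 0 to [i];
   the whole word then carries 0 to [L], which is not 0. *)
suff ev i : (i <= L)%N -> (word_eval rho (take i w) : 'S_L.+1) ord0 = inord i.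
  have := ev L (leqnn _); rewrite take_size ev1 perm1 => /(congr1 val)/=.
  by rewrite inordK// => L00; rewrite -L00 in L0.
elim: i => [|i IHi] iL.
  by rewrite take0 word_eval_nil perm1; apply: val_inj; rewrite /= inordK.
rewrite (take_nth x0)// -cats1 word_eval_cat permM (IHi (ltnW iL)).
rewrite word_eval_cons word_eval_nil mulg1.
have vi : val (inord i : 'I_L.+1) = i by rewrite /= inordK// ltnS ltnW.
have vi1 : val (inord i.+1 : 'I_L.+1) = i.+1 by rewrite /= inordK.
case E: (nth x0 w i) => [k []] /=.
  apply: (can_inj (permK (rho k))); rewrite permKV rhoP; last first.
    by rewrite inE /bwd vi1 /= E eqxx orbT.
  rewrite /st /fwd vi1; case: ifP => // /andP[i1L /eqP wi1].
  by have := nc i i1L; rewrite wi1 E eqxx.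
have f : fwd k (inord i) by rewrite /fwd vi E eqxx iL.
by rewrite rhoP ?inE ?f// /st f vi.
Qed.

(** Precomposition with a surjective endomorphism is injective on the finite set of homomorphisms
    from F_n to S_m, hence bijective. So every such homomorphism factors through the endomorphism
    and kills its kernel, which residual finiteness forces to be trivial. *)
Lemma free_group_hopfian n (al : 'I_n -> free_group n) :
  (forall y, exists x, fghom al x = y) -> bijective (fghom al).
Proof.
move=> sur.
have ker w : fghom al w = 1 -> w = 1.
  move=> alw; apply: contrapT => /eqP /free_group_residually_finite [m [rho]].
  apply/negP; rewrite negbK.
  pose pull (r : {ffun 'I_n -> 'S_m}) := [ffun k => word_eval r (al k)] : {ffun 'I_n -> 'S_m}.
  have pullE r (x : free_group n) : word_eval (pull r) x = word_eval r (fghom al x).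
    by rewrite /fghom -word_eval_comp; apply: eq_word_eval => k; rewrite ffunE.
  have inj_pull : injective pull.
    move=> r1 r2 r12; apply/ffunP => k; have [x xk] := sur (fggen k).
    rewrite -(word_eval_fggen _ r1) -(word_eval_fggen _ r2) -xk.
    by rewrite -!pullE r12.
  have [g _ gK] := injF_bij inj_pull.
  have <- : word_eval (pull (g (finfun rho))) w = word_eval rho w.
    by rewrite gK; apply: eq_word_eval => k; rewrite ffunE.
  by rewrite pullE alw word_eval1.
apply: inj_surj_bij => // x y xy; apply/(mulIg y^-1); rewrite mulgV; apply: ker.
by rewrite /fghom word_evalM word_evalV -!/(fghom _ _) xy mulgV.
Qed.

(** Up to conjugation by [u], the composite of [a], [b] and [ga] is that of [be] and [ga], which is
    onto. Hence [a] is onto, and the Hopf property applies. *)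
Lemma fghom_bij_of_conj n (a b be ga : 'I_n -> free_group n) (u : free_group n) :
  (forall y, exists x, fghom be x = y) -> (forall y, exists x, fghom ga x = y) ->
  (forall k, fghom (fghom a \o b) (ga k) = fghom be (ga k) ^ u) ->
  bijective (fghom a).
Proof.
move=> sbe sga conj; apply: free_group_hopfian => y.
have [z zy] := sbe (y ^ u^-1); have [x xz] := sga z.
exists (fghom b (fghom ga x)).
rewrite -[LHS]/((fghom a \o fghom b) _) fghom_comp -[LHS]/((_ \o _) x) fghom_comp.
have -> : fghom (fghom (fghom a \o b) \o ga) x = fghom (fun k => fghom be (ga k) ^ u) x.
  by apply: eq_word_eval.
by rewrite /fghom word_evalJ word_eval_comp -/(fghom _ _) -/(fghom _ _) xz zy conjgKV.
Qed.

Local Close Scope group_scope.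
Local Open Scope classical_set_scope.
Local Open Scope ring_scope.

(** * Compactness *)

Definition ucont_on {R : realType} {T U : pseudoMetricType R} (A : set T) (f : T -> U) :=
  forall e : R, 0 < e -> exists2 d : R, 0 < d &
    forall x y, A x -> A y -> ball x d y -> ball (f x) e (f y).

Section Compactness.
Context {R : realType}.

Let at_right_filter : ProperFilter (0 : R)^'+.
Proof. exact: at_right_proper_filter. Qed.

Lemma compact_ucont {T U : pseudoMetricType R} (A : set T) (f : T -> U) :
  compact A -> {within A, continuous f} -> ucont_on A f.
Proof.
move=> /compact_near_coveringP cA /subspace_continuousP cf e e0.
pose P (d : R) (x : T) := forall y, A x -> A y -> ball x d y -> ball (f x) e (f y).
suff H : forall x, A x -> \forall x' \near x & d \near 0^'+, P d x'.
  have : \forall d \near (0 : R)^'+, A `<=` P d /\ 0 < d.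
    by apply: filterI; [exact: (cA _ _ P at_right_filter H)|exact: nbhs_right_gt].
  move=> H1; have [d [Pd d0]] := @filter_ex _ _ at_right_filter _ H1.
  by exists d => // x y Ax; exact: (Pd x Ax).
move=> x Ax; have e20 : 0 < e / 2 by rewrite divr_gt0.
have /cvg_ballP/(_ _ e20) := cf x Ax.
rewrite near_withinE near_simpl => /nbhs_ballP[r /= r0 xr].
have r20 : 0 < r / 2 by rewrite divr_gt0.
exists (ball x (r / 2), [set d | d < r / 2]) => /=.
  by split; [exact: nbhsx_ballx|exact: nbhs_right_lt].
move=> [y d] /= [xy dr] z Ay Az yz; rewrite [e]splitr.
apply: (@ball_triangle _ _ (f x)).
  apply/ball_sym/xr => //; rewrite [r]splitr.
  exact: ball_triangle xy (ballxx _ r20).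
apply: xr => //; rewrite [r]splitr; apply: ball_triangle xy _.
by apply: le_ball yz; exact: ltW.
Qed.

(** Near a pair with [f x = g y] the property [good] holds; near any other pair the two values stay
    apart by the Hausdorff property. Compactness of the product makes the radius uniform. *)
Lemma compact_coincidence {T T' U : pseudoMetricType R} (A : set T) (B : set T')
    (f : T -> U) (g : T' -> U) (good : T * T' -> Prop) :
  hausdorff_space U -> compact A -> compact B -> continuous f -> continuous g ->
  (forall x y, A x -> B y -> f x = g y -> \forall z \near (x, y), good z) ->
  exists2 d : R, 0 < d & forall x y, A x -> B y -> ball (f x) d (g y) -> good (x, y).
Proof.
move=> hU cA cB cf cg fg.
have /compact_near_coveringP cAB := compact_setX cA cB.
pose P (d : R) (z : T * T') := ball (f z.1) d (g z.2) -> good z.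
suff H : forall z, (A `*` B) z -> \forall z' \near z & d \near 0^'+, P d z'.
  have : \forall d \near (0 : R)^'+, A `*` B `<=` P d /\ 0 < d.
    by apply: filterI; [exact: (cAB _ _ P at_right_filter H)|exact: nbhs_right_gt].
  move=> H1; have [d [Pd d0]] := @filter_ex _ _ at_right_filter _ H1.
  by exists d => // x y Ax By; exact: (Pd (x, y)).
move=> [x y] [/= Ax By]; have [fxy|fxy] := eqVneq (f x) (g y).
  have [[V1 V2] /= [xV yV] V] := fg x y Ax By fxy.
  exists ([set z | good z], setT) => /=; first by split; [exists (V1, V2)|exact: filterT].
  by move=> [z d] [/= gz _] _.
have := hU; rewrite ball_hausdorff => /(_ _ _ fxy)[[r s] /= /eqP rs].
have r0 : 0 < r%:num by []. have s0 : 0 < s%:num by [].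
set t := Num.min r%:num s%:num / 2.
have t0 : 0 < t by rewrite divr_gt0// lt_min r0 s0.
have tr : t + t <= r%:num by rewrite -splitr ge_min lexx.
have ts2 : t + t <= s%:num by rewrite -splitr ge_min lexx orbT.
have ts : t <= s%:num by lra.
exists ([set z | ball (f x) t (f z.1) /\ ball (g y) t (g z.2)], [set d | d < t]) => /=.
  split; last exact: nbhs_right_lt.
  exists ([set u | ball (f x) t (f u)], [set u | ball (g y) t (g u)]); last by case.
  by split; [exact: (cvg_ball (cf x))|exact: (cvg_ball (cg y))].
move=> [[u v] d] [/= [fu gv] dt] fguv; exfalso.
suff : (ball (f x) r%:num `&` ball (g y) s%:num) (g v) by rewrite rs.
split; last exact: le_ball gv.
apply: le_ball tr _ _; apply: ball_triangle fu _; apply: le_ball fguv; exact: ltW.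
Qed.

(** A pair of distinct points is separated at some stage, and so are all nearby pairs at all later
    stages; pairs near the diagonal are close anyway. Compactness yields one stage beyond which all
    fibres are small, and [compact_coincidence] passes from equal to close images. *)
Lemma tower_small {X : pseudoMetricType R} {U : pseudoMetricType R}
    (q : nat -> X -> U) (g : nat -> U -> U) :
  hausdorff_space U -> compact [set: X] -> (forall i, continuous (q i)) ->
  (forall i x, q i x = g i (q i.+1 x)) ->
  (forall x y, (forall i, q i x = q i y) -> x = y) ->
  forall e : R, 0 < e -> exists J, forall j, (J <= j)%N ->
    exists2 d : R, 0 < d & forall x y, ball (q j x) d (q j y) -> ball x e y.
Proof.
move=> hU cX cq qg sep e e0; have e20 : 0 < e / 2 by rewrite divr_gt0.
have /compact_near_coveringP cXX := compact_setX cX cX.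
have qS i j x y : (i <= j)%N -> q j x = q j y -> q i x = q i y.
  by elim: j i => [|j IHj] i; [rewrite leqn0 => /eqP ->|
    rewrite leq_eqVlt => /orP[/eqP -> //|/IHj H xy]; apply: H; rewrite (qg j x) (qg j y) xy].
pose P (j : nat) (z : X * X) := q j z.1 = q j z.2 -> ball z.1 (e / 2) z.2.
suff H : forall z, ([set: X] `*` [set: X]) z -> \forall z' \near z & j \near \oo, P j z'.
  have [J _ PJ] := cXX _ _ P eventually_filter H; exists J => j Jj.
  pose good (z : X * X) := ball z.1 e z.2.
  have [|d d0 dP] := @compact_coincidence X X U setT setT (q j) (q j) good hU
    cX cX (cq j) (cq j); last by exists d => // x y; exact: dP.
  move=> x y _ _ /(PJ j Jj (x, y) (conj I I)) /= xy.
  have e40 : 0 < e / 4 by rewrite divr_gt0.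
  exists (ball x (e / 4), ball y (e / 4)) => /=; first by split; exact: nbhsx_ballx.
  move=> [u v] /= [xu yv]; rewrite /good /=; have -> : e = e / 4 + (e / 2 + e / 4) by field.
  exact: ball_triangle (ball_sym xu) (ball_triangle xy yv).
move=> [x y] _; have [xy|/existsNP[i qi]] := pselect (forall i, q i x = q i y).
  have {y xy} <- := sep x y xy; have e40 : 0 < e / 4 by rewrite divr_gt0.
  exists (ball x (e / 4) `*` ball x (e / 4), setT) => /=.
    split; last exact: filterT.
    by exists (ball x (e / 4), ball x (e / 4)) => //; split; exact: nbhsx_ballx.
  move=> [[u v] j] /= [[xu xv] _] _; have -> : e / 2 = e / 4 + e / 4 by field.
  exact: ball_triangle (ball_sym xu) xv.
have hq : \forall z \near (x, y), q i z.1 != q i z.2.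
  move/eqP: qi => qi; have := hU; rewrite open_hausdorff => /(_ _ _ qi).
  move=> [[A B] /= [/set_mem Ax /set_mem By] [oA oB /eqP AB]].
  exists (q i @^-1` A, q i @^-1` B) => /=.
    by split; apply: cq; exact: open_nbhs_nbhs.
  move=> [u v] /= [Au Bv]; apply/eqP => uv.
  have : (A `&` B) (q i v) by split => //; rewrite -uv.
  by rewrite AB.
exists ([set z | q i z.1 != q i z.2], [set j | (i <= j)%N]) => /=.
  by split => //; exists i.
by move=> [[u v] j] /= [/eqP uv ij] /(qS _ _ _ _ ij).
Qed.

End Compactness.

(** * Flat cocycles *)

(** These are Alexander-Spanier 1-cocycles with values in a possibly nonabelian group: arbitrary
    functions, without continuity, considered only near the diagonal, at a uniform scale. In
    [cohomologous] the transfer function [v] is likewise arbitrary. *)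
Definition flat_on {R : realType} {T : pseudoMetricType R} {G : groupType} (A : set T)
    (c : T -> T -> G) :=
  exists2 d : R, 0 < d & forall x y z, A x -> A y -> A z ->
    ball x d y -> ball y d z -> ball x d z -> (c x y * c y z)%g = c x z.

Definition cohomologous {R : realType} {T : pseudoMetricType R} {G : groupType}
    (A : set T) (c c' : T -> T -> G) :=
  exists v : T -> G, exists2 d : R, 0 < d & forall x y, A x -> A y -> ball x d y ->
    c x y = ((v x)^-1 * c' x y * v y)%g.

Lemma ball_minl {R : realType} {T : pseudoMetricType R} (x y : T) (d d' : R) :
  ball x (Num.min d d') y -> ball x d y.
Proof. by apply: le_ball; rewrite ge_min lexx. Qed.

Lemma ball_minr {R : realType} {T : pseudoMetricType R} (x y : T) (d d' : R) :
  ball x (Num.min d d') y -> ball x d' y.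
Proof. by apply: le_ball; rewrite ge_min lexx orbT. Qed.

Section Cocycles.
Context {R : realType} {G : groupType}.
Implicit Types T U : pseudoMetricType R.

Lemma flat_diag {T} (A : set T) (c : T -> T -> G) x : flat_on A c -> A x -> c x x = 1%g.
Proof.
move=> [d d0 cP] Ax; apply: (mulgI (c x x)).
by rewrite mulg1 cP//; exact: ballxx.
Qed.

Lemma flat_comp {T U} (A : set T) (B : set U) (f : T -> U) (c : U -> U -> G) :
  ucont_on A f -> (forall x, A x -> B (f x)) -> flat_on B c ->
  flat_on A (fun x y => c (f x) (f y)).
Proof.
move=> uf fAB [d d0 cP]; have [e e0 fe] := uf d d0.
by exists e => // x y z Ax Ay Az xy yz xz; apply: cP; auto.
Qed.

Lemma coh_sym {T} (A : set T) (c c' : T -> T -> G) :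
  cohomologous A c c' -> cohomologous A c' c.
Proof.
move=> [v [d d0 cP]]; exists (fun x => (v x)^-1%g), d => // x y Ax Ay xy.
by rewrite cP// invgK !mulgA mulgV mul1g mulgK.
Qed.

Lemma coh_trans {T} (A : set T) (c c' c'' : T -> T -> G) :
  cohomologous A c c' -> cohomologous A c' c'' -> cohomologous A c c''.
Proof.
move=> [v [d d0 cP]] [v' [d' d'0 cP']]; exists (fun x => (v' x * v x)%g).
exists (Num.min d d'); first by rewrite lt_min d0.
move=> x y Ax Ay xy; rewrite cP//; last exact: ball_minl xy.
by rewrite cP' ?invgM ?mulgA//; exact: ball_minr xy.
Qed.

Lemma eq_coh {T} (A : set T) (c c' : T -> T -> G) :
  (forall x y, A x -> A y -> c x y = c' x y) -> cohomologous A c c'.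
Proof.
move=> cc'; exists (fun _ => 1%g), 1 => // x y Ax Ay _.
by rewrite invg1 mul1g mulg1 cc'.
Qed.

Lemma coh_comp {T U} (A : set T) (B : set U) (f : T -> U) (c c' : U -> U -> G) :
  ucont_on A f -> (forall x, A x -> B (f x)) -> cohomologous B c c' ->
  cohomologous A (fun x y => c (f x) (f y)) (fun x y => c' (f x) (f y)).
Proof.
move=> uf fAB [v [d d0 cP]]; have [e e0 fe] := uf d d0.
by exists (v \o f), e => // x y Ax Ay xy; rewrite cP/=; auto.
Qed.

(** Moving [x] inside its small fibre to the chosen point [s (q x)] changes [c] by the coboundary of
    [c (s (q x)) x]. Thus [c] descends along [q] even though the section need not be continuous. *)
Lemma flat_section {T U} (B : set U) (q : T -> U) (s : U -> T) (c : T -> T -> G)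
    (d e : R) :
  ucont_on setT q -> 0 < e -> (forall x, B (q x)) -> (forall u, B u -> q (s u) = u) ->
  (forall x y, ball (q x) e (q y) -> ball x d y) ->
  (forall x y z, ball x d y -> ball y d z -> ball x d z -> (c x y * c y z)%g = c x z) ->
  cohomologous setT c (fun x y => c (s (q x)) (s (q y))).
Proof.
move=> uq e0 qB qs small cP; have [r r0 qr] := uq e e0.
have sq x : q (s (q x)) = q x by apply: qs.
exists (fun x => c (s (q x)) x), r => // x y _ _ /(qr _ _ I I) xy.
have sm u v : ball (q x) e (q y) -> q u = q x -> q v = q y -> ball u d v.
  by move=> xy' ux vy; apply: small; rewrite ux vy.
have xx : ball (q x) e (q x) by exact: ballxx.
have smx u v : q u = q x -> q v = q x -> ball u d v.
  by move=> ux vx; apply: small; rewrite ux vx.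
have smy u v : q u = q y -> q v = q y -> ball u d v.
  by move=> ux vx; apply: small; rewrite ux vx; exact: ballxx.
have -> : (c (s (q x)) x)^-1%g = c x (s (q x)).
  apply: mulg1_eq; rewrite cP; [|exact: smx|exact: smx|exact: smx].
  apply: (mulgI (c (s (q x)) (s (q x)))).
  by rewrite mulg1 cP//; exact: smx.
rewrite cP; [|exact: smx|exact: sm|exact: sm].
by rewrite cP; [|exact: sm|exact: smy|exact: sm].
Qed.

End Cocycles.

Lemma coh_morph {R : realType} {T : pseudoMetricType R} {G G' : groupType}
    (h : G -> G') (A : set T) (c c' : T -> T -> G) :
  {morph h : x y / (x * y)%g} -> {morph h : x / x^-1%g} ->
  cohomologous A c c' ->
  cohomologous A (fun x y => h (c x y)) (fun x y => h (c' x y)).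
Proof.
move=> hM hV [v [d d0 cP]]; exists (h \o v), d => // x y Ax Ay xy.
by rewrite cP// !hM hV.
Qed.

(** * Cocycles along an interval *)

Section Paths.
Context {R : realType}.

Lemma ballR (t d t' : R) : ball t d t' = (`|t - t'| < d) :> Prop.
Proof. by rewrite -ball_normE. Qed.

Lemma locally_constant {V : Type} (K : R -> V) (a b d : R) : a <= b -> 0 < d ->
  (forall t t', a <= t <= b -> a <= t' <= b -> ball t d t' -> K t = K t') -> K a = K b.
Proof.
move=> ab d0 Kd; have e0 : 0 < d / 2 by rewrite divr_gt0.
have H N t : a <= t <= b -> t - a <= N%:R * (d / 2) -> K a = K t.
  elim: N t => [|N IHN] t atb.
    by rewrite mul0r => ta; congr K; apply/eqP; rewrite eq_le (andP atb).1/=; lra.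
  rewrite -natr1 mulrDl mul1r => taN; have [ta|ta] := leP (t - d / 2) a.
    by apply: Kd => //; [rewrite lexx|rewrite ballR ltr_norml; lra].
  rewrite (IHN (t - d / 2)); [|lra|lra].
  by apply: Kd => //; [lra|rewrite ballR ltr_norml; lra].
have ba0 : 0 <= (b - a) / (d / 2) by rewrite divr_ge0 ?subr_ge0// ltW.
apply: (H (Num.bound ((b - a) / (d / 2)))); first by rewrite ab lexx.
by rewrite -ler_pdivrMr//; exact/ltW/archi_boundP.
Qed.

(** The interval is covered by steps of half the flatness radius. A primitive up to [m] is continued
    beyond [m] by [H m * c m t], and flatness shows that the two pieces fit. *)
Lemma primitive {G : groupType} (c : R -> R -> G) :
  flat_on [set t : R | 0 <= t <= 1] c ->
  exists H : R -> G, H 0 = 1%g /\ exists2 d : R, 0 < d & forall t t' : R,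
    0 <= t <= 1 -> 0 <= t' <= 1 -> ball t d t' -> c t t' = ((H t)^-1 * H t')%g.
Proof.
move=> flc; have := flc => -[d d0 cP]; set e := d / 2.
have e0 : 0 < e by rewrite divr_gt0.
have de : d = e + e by rewrite /e; lra.
suff HN N : exists H : R -> G, H 0 = 1%g /\ forall t t' : R, 0 <= t <= 1 -> 0 <= t' <= 1 ->
    t <= N%:R * e -> t' <= N%:R * e -> `|t - t'| < e -> c t t' = ((H t)^-1 * H t')%g.
  have [H [H0 HP]] := HN (Num.bound (e^-1)); exists H; split => //.
  exists e => // t t' t01 t'01; rewrite ballR => tt'; apply: HP => //.
    apply: (le_trans (andP t01).2); rewrite -ler_pdivrMr// div1r.
    by apply/ltW/archi_boundP; rewrite invr_ge0 ltW.
  apply: (le_trans (andP t'01).2); rewrite -ler_pdivrMr// div1r.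
  by apply/ltW/archi_boundP; rewrite invr_ge0 ltW.
elim: N => [|N [H [H0 HP]]].
  exists (fun _ => 1%g); split => // t t' t01 t'01; rewrite mul0r => t0 t'0 _.
  have -> : t = 0 by lra.
  have -> : t' = 0 by lra.
  by rewrite (flat_diag _ _ _ flc)/= ?lexx ?ler01// invg1 mulg1.
set m := N%:R * e; have mS : N.+1%:R * e = m + e by rewrite -natr1 mulrDl mul1r.
have m0 : 0 <= m by rewrite mulr_ge0// ltW.
have [m1|m1] := leP m 1; last first.
  by exists H; split => // t t' t01 t'01 _ _; apply: HP => //; rewrite -/m; lra.
have m01 : 0 <= m <= 1 by rewrite m0.
have cc t t' t'' : 0 <= t <= 1 -> 0 <= t' <= 1 -> 0 <= t'' <= 1 ->
    `|t - t'| < d -> `|t' - t''| < d -> `|t - t''| < d -> (c t t' * c t' t'')%g = c t t''.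
  by move=> *; apply: cP => //; rewrite ballR.
have c1 t : 0 <= t <= 1 -> c t t = 1%g by move=> t01; apply: flat_diag flc _.
have cV t t' : 0 <= t <= 1 -> 0 <= t' <= 1 -> `|t - t'| < d -> c t t' = (c t' t)^-1%g.
  move=> t01 t'01 tt'; apply/esym/mulg1_eq.
  by rewrite cc// 1?distrC ?c1// subrr normr0.
exists (fun t => if t <= m then H t else (H m * c m t)%g); split; first by rewrite m0.
rewrite mS => t t' t01 t'01 tm t'm tt'.
have := tt'; rewrite ltr_norml => /andP[tt1 tt2].
have [ltm|ltm] := leP t m; have [lt'm|lt'm] := leP t' m.
- exact: HP.
- rewrite mulgA -HP//; last by rewrite ltr_norml; lra.
  by rewrite cc//; rewrite ltr_norml; lra.
- rewrite invgM -mulgA -HP//; last by rewrite ltr_norml; lra.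
  by rewrite -cV// ?cc//; rewrite ltr_norml; lra.
by rewrite invgM -!mulgA mulKg -cV// ?cc//; rewrite ltr_norml; lra.
Qed.

End Paths.

(** * The wedge of circles *)

Section Wedge.
Context {R : realType} {n : nat}.
Implicit Types (k : 'I_n) (t : R).

(** The difference of the two angles has cosine 1, so by the double angle formula the sine of
    [pi * |t - t'|] vanishes, with that argument in [0, pi). *)
Lemma circle_inj (t t' : R) : `|t - t'| < 1 ->
  cos (pi *+ 2 * t) = cos (pi *+ 2 * t') -> sin (pi *+ 2 * t) = sin (pi *+ 2 * t') ->
  t = t'.
Proof.
move=> tt' ec es; set b := pi * `|t - t'|.
have : cos (b *+ 2) = 1.
  have -> : cos (b *+ 2) = cos (pi *+ 2 * t - pi *+ 2 * t').
    rewrite /b -mulrBr; case: (ger0P (t - t')) => _.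
      by rewrite -mulrnAl.
    by rewrite -mulrnAl mulrN cosN.
  by rewrite cosB ec es -!expr2 cos2Dsin2.
rewrite cos_mulr2n => cb.
have sb : sin b ^+ 2 = 0 by have := cos2Dsin2 b; lra.
move/eqP: sb; rewrite sqrf_eq0 => /eqP sb.
apply/eqP; rewrite -subr_eq0 -normr_eq0; apply/eqP.
have := normr_ge0 (t - t'); rewrite le_eqVlt => /orP[/eqP <- //|tt0].
have pi0 := pi_gt0 R.
have : 0 < sin b by apply: sin_gt0_pi; rewrite mulr_gt0//= gtr_pMr.
by rewrite sb ltxx.
Qed.

Lemma gam0 k : gam k (0 : R) = wpt.
Proof. by rewrite /gam mulr0 cos0 sin0 mulr1 subrr mulr0. Qed.

Lemma gamDn k t (m : nat) : gam k (t + m%:R) = gam k t.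
Proof.
rewrite /gam; have -> : pi *+ 2 * (t + m%:R) = pi *+ 2 * t + pi *+ 2 *+ m :> R.
  by rewrite mulrDr mulr_natr.
by rewrite (periodicn (@cosD2pi R)) (periodicn (@sinD2pi R)).
Qed.

Lemma gam1 k : gam k (1 : R) = wpt.
Proof. by rewrite -[1]add0r (gamDn _ _ 1) gam0. Qed.

Lemma gam_wedge k t : wedgeW n (gam k t).
Proof. by exists k, t. Qed.

Lemma wedgeP (z : R * R) : wedgeW n z ->
  exists k t, [/\ 0 <= t < 1, 0 <= t <= 1 & z = gam k t].
Proof.
move=> [k [t ->]]; have /andP[t1 t2] := floor_itv t.
set u := t - (Num.floor t)%:~R.
have u01 : 0 <= u < 1 by move: t2; rewrite intrD /u; lra.
exists k, u; split => //; first by lra.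
have -> : t = u + (Num.floor t)%:~R by rewrite /u subrK.
case: (Num.floor t) => m; first by rewrite -pmulrn gamDn.
by rewrite -[in RHS](subrK m.+1%:R u) gamDn NegzE mulrNz.
Qed.

(** The circle of radius r has equation x^2 + y^2 = 2 r x. Since [t] is interior, x is nonzero, so
    the point determines r and with it the circle. *)
Lemma gam_inj k k' t t' : 0 < t < 1 -> 0 <= t' <= 1 -> gam k t = gam k' t' ->
  k = k' /\ t = t'.
Proof.
move=> t01 t'01; rewrite /gam => -[]; set r := wrad k; set r' := wrad k'.
set C := cos _; set S := sin _; set C' := cos _; set S' := sin _ => ex ey.
have r0 : 0 < r by rewrite invr_gt0 ltr0n.
have r'0 : 0 < r' by rewrite invr_gt0 ltr0n.
have CS : C ^+ 2 + S ^+ 2 = 1 by exact: cos2Dsin2.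
have CS' : C' ^+ 2 + S' ^+ 2 = 1 by exact: cos2Dsin2.
have C1 : C != 1.
  apply/eqP => C1; have S0 : S = 0.
    by apply/eqP; rewrite -sqrf_eq0; apply/eqP; rewrite C1 in CS; lra.
  suff : t = 0 by lra.
  apply: circle_inj; first by rewrite ltr_norml; lra.
    by rewrite mulr0 cos0 -C1.
  by rewrite mulr0 sin0 -S0.
have x0 : r - r * C != 0.
  by rewrite -[X in X - _]mulr1 -mulrBr mulf_eq0 negb_or gt_eqF//= subr_eq0 eq_sym.
have rr : r = r'.
  apply: (mulIf x0).
  have e1 : (r - r * C) ^+ 2 + (r * S) ^+ 2 = 2 * r * (r - r * C).
    by rewrite [X in _ + X]exprMn (_ : S ^+ 2 = 1 - C ^+ 2); [ring|lra].
  have e2 : (r' - r' * C') ^+ 2 + (r' * S') ^+ 2 = 2 * r' * (r' - r' * C').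
    by rewrite [X in _ + X]exprMn (_ : S' ^+ 2 = 1 - C' ^+ 2); [ring|lra].
  by move: e2; rewrite -ex -ey e1; lra.
have kk : k = k'.
  move: rr; rewrite /r /r' /wrad => /invr_inj/eqP; rewrite eqr_nat eqSS => /eqP.
  exact: val_inj.
split => //; apply: circle_inj; first by rewrite ltr_norml; lra.
  by apply: (mulfI (lt0r_neq0 r0)); move: ex; rewrite -rr -/C -/C'; lra.
by apply: (mulfI (lt0r_neq0 r0)); move: ey; rewrite -rr -/S -/S'.
Qed.

Arguments gam_inj {k k' t t'}.

Lemma gam_continuous k : continuous (gam k : R -> R * R).
Proof.
move=> t; have ct : continuous (fun u : R => pi *+ 2 * u).
  by move=> u; apply: cvgM; [exact: cvg_cst|exact: cvg_id].
apply: (@cvg_pair _ _ _ _ (nbhs (gam k t).1) (nbhs (gam k t).2)) => /=.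
  apply: cvgB; first exact: cvg_cst.
  apply: cvgM; first exact: cvg_cst.
  by apply: (continuous_comp (ct t)); exact: continuous_cos.
apply: cvgM; first exact: cvg_cst.
by apply: (continuous_comp (ct t)); exact: continuous_sin.
Qed.

Lemma gam_ucont k : ucont_on [set t : R | 0 <= t <= 1] (gam k).
Proof.
apply: compact_ucont; last exact/continuous_subspaceT/gam_continuous.
by have := @segment_compact R 0 1; rewrite set_itvE.
Qed.

Lemma wedge_compact : compact (@wedgeW R n).
Proof.
have -> : @wedgeW R n = \big[setU/set0]_(k < n) (gam k @` `[0, 1]%classic).
  apply/seteqP; split => z.
    move=> /wedgeP[k [t [_ t01 ->]]]; rewrite -bigcup_seq/=.
    by exists k; rewrite /= ?mem_index_enum//; exists t; rewrite //= in_itv.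
  by rewrite -bigcup_seq => -[k _ [t _ <-]]; exact: gam_wedge.
apply: bigsetU_compact => k _; apply: continuous_compact; last exact: segment_compact.
exact/continuous_subspaceT/gam_continuous.
Qed.

Definition near_end (d t : R) : bool := (t < d) || (1 - d < t).

Lemma finite_radius (I : finType) (P : I -> R -> Prop) :
  (forall i d d', 0 < d' -> d' <= d -> P i d -> P i d') ->
  (forall i, exists2 d, 0 < d & P i d) -> exists2 d, 0 < d & forall i, P i d.
Proof.
move=> mono H; suff [d d0 dP] : exists2 d, 0 < d & forall i, i \in enum I -> P i d.
  by exists d => // i; apply: dP; rewrite mem_enum.
elim: (enum I) => [|i s [d d0 IH]]; first by exists 1.
have [d' d'0 Pd'] := H i; exists (Num.min d d'); first by rewrite lt_min d0.
have m0 : 0 < Num.min d d' by rewrite lt_min d0.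
move=> j; rewrite inE => /orP[/eqP ->|/IH Pd].
  by apply: mono Pd' => //; rewrite ge_min lexx orbT.
by apply: mono Pd => //; rewrite ge_min lexx.
Qed.

(** By [compact_coincidence] it is enough to look at actual coincidences: either circle and
    parameter agree, or both parameters are endpoints of the unit interval. *)
Lemma gam_close (d : R) : 0 < d -> exists2 e, 0 < e & forall k k' t t',
  0 <= t <= 1 -> 0 <= t' <= 1 -> ball (gam k t) e (gam k' t') ->
  (k = k' /\ `|t - t'| < d) \/ (near_end d t /\ near_end d t').
Proof.
move=> d0; pose P (kk : 'I_n * 'I_n) (e : R) := forall t t' : R,
  0 <= t <= 1 -> 0 <= t' <= 1 -> ball (gam kk.1 t) e (gam kk.2 t') ->
  (kk.1 = kk.2 /\ `|t - t'| < d) \/ (near_end d t /\ near_end d t').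
suff [e e0 eP] : exists2 e, 0 < e & forall kk, P kk e.
  by exists e => // k k' t t'; apply: (eP (k, k')).
apply: finite_radius => [kk e e' _ le_e Pe t t' t01 t'01 h|[k k']].
  by apply: Pe => //; exact: le_ball h.
pose good (z : R * R) := (k = k' /\ `|z.1 - z.2| < d) \/ (near_end d z.1 /\ near_end d z.2).
have d20 : 0 < d / 2 by rewrite divr_gt0.
have goodP (x y : R) : 0 <= x <= 1 -> 0 <= y <= 1 -> gam k x = gam k' y ->
    \forall z \near (x, y), good z.
  move=> x01 y01 exy; have bxy : nbhs (x, y) (ball x (d / 2) `*` ball y (d / 2)).
    by exists (ball x (d / 2), ball y (d / 2)) => //; split; exact: nbhsx_ballx.
  have [[kk xy]|[xe ye]] : (k = k' /\ x = y) \/ ((x = 0 \/ x = 1) /\ (y = 0 \/ y = 1)).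
    have [x0|x0] := boolP (0 < x < 1); first by left; exact: gam_inj exy.
    have [y0|y0] := boolP (0 < y < 1).
      by left; have [-> ->] := gam_inj y0 x01 (esym exy).
    right; move: x0 y0; rewrite !negb_and -!leNgt => x0 y0.
    split; [move/orP: x0 => [?|?]|move/orP: y0 => [?|?]].
    - by left; lra.
    - by right; lra.
    - by left; lra.
    - by right; lra.
  - apply: filterS bxy => -[u v] /= [/=]; rewrite -xy !ballR !ltr_norml => xu xv.
    by left; split => //=; rewrite ltr_norml; lra.
  apply: filterS bxy => -[u v] /= [/=]; rewrite !ballR !ltr_norml => xu yv.
  right; rewrite /near_end /=.
  by split; apply/orP; [case: xe => xe|case: ye => ye]; [left|right|left|right]; lra.
have cI : compact [set t : R | 0 <= t <= 1].
  by have := @segment_compact R 0 1; rewrite set_itvE.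
have hRR : hausdorff_space (R * R)%type by exact: norm_hausdorff.
have [e e0 eP] := compact_coincidence _ _ _ _ good hRR cI cI (gam_continuous k) (gam_continuous k') goodP.
by exists e => // t t' t01 t'01; exact: eP.
Qed.

End Wedge.

Arguments gam_inj {R n k k' t t'}.

(** * Classification of flat cocycles on the wedge by holonomy *)

Section WedgeCocycle.
Context {R : realType} {n : nat} {G : groupType}.
Implicit Types (k : 'I_n) (t : R) (z : R * R) (al : 'I_n -> G).

Definition second_half k z := exists t, 1 / 2 <= t < 1 /\ z = gam k t.

Definition near_wpt z := exists k t, [/\ 0 <= t <= 1, near_end (1 / 4) t & z = gam k t].

(** A potential with two jumps on each circle: at the point opposite to the wedge point and at the
    wedge point. [wedge_cocycle] suppresses the second jump by taking the value 1 near the wedge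
    point, which leaves holonomy [al k]. *)
Definition wedge_side al z : G :=
  if [pick k | `[< second_half k z >]] is Some k then al k else 1%g.

(* The universal cocycle: crossing the point opposite to the wedge point on the
   k-th circle contributes [al k]. *)
Definition wedge_cocycle al z z' : G :=
  if `[< near_wpt z >] && `[< near_wpt z' >] then 1%g
  else ((wedge_side al z)^-1 * wedge_side al z')%g.

(** The potential on the circle cut open at the wedge point: at [t = 1] it keeps the value [al k],
    whereas [wedge_side] has returned to 1. *)
Definition edge_step al k t : G := if 1 / 2 <= t then al k else 1%g.

Lemma edge_step0 al k : edge_step al k 0 = 1%g.
Proof. by rewrite /edge_step ifN//; lra. Qed.

Lemma edge_step1 al k : edge_step al k 1 = al k.
Proof. by rewrite /edge_step ifT//; lra. Qed.

Lemma wedge_side_gam al k t : 0 <= t < 1 -> wedge_side al (gam k t) = edge_step al k t.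
Proof.
move=> t01; rewrite /wedge_side /edge_step.
case: pickP => [k' /asboolP[t' [t'12 e]]|no].
  have t'01 : 0 < t' < 1 by lra.
  have tI : 0 <= t <= 1 by lra.
  have [-> tt'] := gam_inj t'01 tI (esym e).
  by rewrite -tt' (andP t'12).1.
case: ifP => // t12; have /asboolP := no k; case.
by exists t; rewrite t12 (andP t01).2.
Qed.

Lemma near_wpt_gam k t : 0 <= t <= 1 -> `[< near_wpt (gam k t) >] = near_end (1 / 4) t.
Proof.
move=> tI; apply/asboolP/idP => [[k' [t' [t'I t'e e]]]|te]; last by exists k, t.
have [t0|/negP t0] := boolP (0 < t < 1); last by rewrite /near_end; lra.
by have [_ ->] := gam_inj t0 t'I e.
Qed.

Lemma wedge_cocycle_near al z z' : near_wpt z -> near_wpt z' -> wedge_cocycle al z z' = 1%g.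
Proof. by move=> /asboolP nz /asboolP nz'; rewrite /wedge_cocycle nz nz'. Qed.

(** If both parameters are within 1/4 of an end, the bound 1/8 keeps them on the same side of 1/2.
    Otherwise both are below 1, where [wedge_side] and [edge_step] agree. *)
Lemma wedge_cocycle_gam al k t t' : 0 <= t <= 1 -> 0 <= t' <= 1 -> `|t - t'| < 1 / 8 ->
  wedge_cocycle al (gam k t) (gam k t') = ((edge_step al k t)^-1 * edge_step al k t')%g.
Proof.
move=> tI t'I; rewrite ltr_norml => tt'; rewrite /wedge_cocycle !near_wpt_gam//.
case: ifP => [|ne].
  rewrite /near_end /edge_step => tet'e.
  suff -> : (1 / 2 <= t) = (1 / 2 <= t') by rewrite mulVg.
  by apply/idP/idP; lra.
by rewrite !wedge_side_gam//; move: ne; rewrite /near_end; lra.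
Qed.

(** If one of the three points is not near the wedge point, all three lie on its circle and the
    cocycle is a coboundary there; otherwise all three values are 1. A parameter 1/8-close to one
    outside the 1/4 zones is outside the 1/8 zones, which settles the remaining pair. *)
Lemma wedge_cocycle_flat al : flat_on (@wedgeW R n) (wedge_cocycle al).
Proof.
have d0 : 0 < 1 / 8 :> R by lra.
have [e e0 eP] := @gam_close R n _ d0; exists e => // x y z.
move=> /wedgeP[k [t [t1 tI ->]]] /wedgeP[k' [t' [t'1 t'I ->]]].
move=> /wedgeP[k'' [t'' [t''1 t''I ->]]] /eP xy /eP yz /eP xz.
have {}xy := xy tI t'I; have {}yz := yz t'I t''I; have {}xz := xz tI t''I.
have same : [/\ k = k', k' = k'', `|t - t'| < 1 / 8, `|t' - t''| < 1 / 8 &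
    `|t - t''| < 1 / 8] -> (wedge_cocycle al (gam k t) (gam k' t') *
    wedge_cocycle al (gam k' t') (gam k'' t''))%g = wedge_cocycle al (gam k t) (gam k'' t'').
  move=> [<- <- a b c]; rewrite !wedge_cocycle_gam//.
  by rewrite mulgA mulgK.
have far (u u' : R) (l l' : 'I_n) : ~~ near_end (1 / 4) u ->
    (l = l' /\ `|u - u'| < 1 / 8) \/ (near_end (1 / 8) u /\ near_end (1 / 8) u') ->
    [/\ l = l' :> 'I_n, `|u - u'| < 1 / 8 & ~~ near_end (1 / 8) u'].
  rewrite /near_end => ue [[ll uu]|]; last by lra.
  by split => //; move: uu; rewrite ltr_norml; lra.
have far' (u u' : R) (l l' : 'I_n) : ~~ near_end (1 / 4) u' ->
    (l = l' /\ `|u - u'| < 1 / 8) \/ (near_end (1 / 8) u /\ near_end (1 / 8) u') ->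
    [/\ l = l' :> 'I_n, `|u - u'| < 1 / 8 & ~~ near_end (1 / 8) u].
  rewrite /near_end => ue [[ll uu]|]; last by lra.
  by split => //; move: uu; rewrite ltr_norml; lra.
have third (u u' : R) (l l' : 'I_n) : ~~ near_end (1 / 8) u ->
    (l = l' /\ `|u - u'| < 1 / 8) \/ (near_end (1 / 8) u /\ near_end (1 / 8) u') ->
    `|u - u'| < 1 / 8.
  by move=> /negP nu [[]//|[]].
have [te|te] := boolP (near_end (1 / 4) t); last first.
  have [? ? nt'] := far _ _ _ _ te xy; have [? ? _] := far _ _ _ _ te xz.
  by apply: same; split=> //; [congruence|exact: third _ _ _ _ nt' yz].
have [t'e|t'e] := boolP (near_end (1 / 4) t'); last first.
  have [? ? nt] := far' _ _ _ _ t'e xy; have [? ? _] := far _ _ _ _ t'e yz.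
  by apply: same; split=> //; exact: third _ _ _ _ nt xz.
have [t''e|t''e] := boolP (near_end (1 / 4) t''); last first.
  have [? ? nt] := far' _ _ _ _ t''e xz; have [? ? _] := far' _ _ _ _ t''e yz.
  by apply: same; split=> //; [congruence|exact: third _ _ _ _ nt xy].
by rewrite !wedge_cocycle_near ?mulg1//; [exists k, t|exists k'', t''|exists k', t'
  |exists k'', t''|exists k, t|exists k', t'].
Qed.

(** On each circle the transfer function is the quotient [V] of the two primitives. It is 1 at both
    ends, so the pieces glue to a function on the wedge. *)
Lemma flat_coh_wedge (c : R * R -> R * R -> G) (H : 'I_n -> R -> G) :
  flat_on (@wedgeW R n) c -> (forall k, H k 0 = 1%g) ->
  (forall k, exists2 d : R, 0 < d & forall t t' : R, 0 <= t <= 1 -> 0 <= t' <= 1 ->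
     ball t d t' -> c (gam k t) (gam k t') = ((H k t)^-1 * H k t')%g) ->
  cohomologous (@wedgeW R n) c (wedge_cocycle (fun k => H k 1)).
Proof.
move=> flc H0 HP; set al := fun k => H k 1.
pose V k t := ((edge_step al k t)^-1 * H k t)%g.
have V0 k : V k 0 = 1%g.
  by rewrite /V edge_step0 H0 invg1 mulg1.
have V1 k : V k 1 = 1%g by rewrite /V edge_step1 mulVg.
have VE k k' t t' : 0 <= t <= 1 -> 0 <= t' <= 1 -> gam k t = gam k' t' -> V k t = V k' t'.
  move=> tI t'I e; have [t0|t0] := boolP (0 < t < 1).
    by have [-> ->] := gam_inj t0 t'I e.
  have [t'0|t'0] := boolP (0 < t' < 1).
    by have [-> ->] := gam_inj t'0 tI (esym e).
  have : t = 0 \/ t = 1.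
    by have [?|?] := ltP 0 t; [right|left]; move/negP: t0; lra.
  have : t' = 0 \/ t' = 1.
    by have [?|?] := ltP 0 t'; [right|left]; move/negP: t'0; lra.
  by move=> [->|->] [->|->]; rewrite ?V0 ?V1.
have [v vP] : {v : R * R -> G & forall z k t, 0 <= t <= 1 -> z = gam k t -> v z = V k t}.
  apply: (@choice _ _ (fun z g => forall k t, 0 <= t <= 1 -> z = gam k t -> g = V k t)) => z.
  have [[k0 [t0 [t0I e0]]]|no] := pselect (exists k t, 0 <= t <= 1 /\ z = gam k t).
    by exists (V k0 t0) => k t tI e; apply: VE => //; rewrite -e0.
  by exists 1%g => k t tI e; case: no; exists k, t.
have [d d0 dP] : exists2 d : R, 0 < d & forall k, forall t t' : R, 0 <= t <= 1 ->
    0 <= t' <= 1 -> ball t d t' -> c (gam k t) (gam k t') = ((H k t)^-1 * H k t')%g.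
  apply: finite_radius HP => k d d' _ dd' dP t t' tI t'I tt'.
  by apply: dP => //; exact: le_ball tt'.
have edge k t t' : 0 <= t <= 1 -> 0 <= t' <= 1 -> `|t - t'| < d -> `|t - t'| < 1 / 8 ->
    c (gam k t) (gam k t') =
    ((v (gam k t))^-1 * wedge_cocycle al (gam k t) (gam k t') * v (gam k t'))%g.
  move=> tI t'I td t8; rewrite dP ?ballR// wedge_cocycle_gam//.
  rewrite (vP _ k t)// (vP _ k t')// /V invgM invgK.
  by rewrite !mulgA mulgK mulgK.
have [r r0 flr] := flc.
have [s s0 sP] : exists2 s : R, 0 < s & forall k, forall t t' : R, 0 <= t <= 1 ->
    0 <= t' <= 1 -> ball t s t' -> ball (gam k t) r (gam k t').
  apply: finite_radius => [k s s' _ ss' sP t t' tI t'I tt'|k].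
    by apply: sP => //; exact: le_ball tt'.
  by have [s s0 sP] := gam_ucont k r r0; exists s.
pose m := Num.min (Num.min d s) (1 / 8).
have m0 : 0 < m by rewrite !lt_min d0 s0/=; lra.
have [md ms m8] : [/\ m <= d, m <= s & m <= 1 / 8] by rewrite !ge_min !lexx !orbT.
have [e e0 eP] := @gam_close R n _ m0.
exists v, (Num.min e r); first by rewrite lt_min e0.
move=> x y /wedgeP[k [t [t1 tI ->]]] /wedgeP[k' [t' [t'1 t'I ->]]] xy.
have xyr := ball_minr _ _ _ _ xy.
have [[<- tt']|[te t'e]] := eP _ _ _ _ tI t'I (ball_minl _ _ _ _ xy).
  by apply: edge => //; exact: lt_le_trans tt' _.
have z0 : wpt = gam k (0 : R) by rewrite gam0.
have vw : v wpt = 1%g by rewrite (vP _ k 0) ?lexx ?ler01.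
have nw : near_wpt wpt by exists k, 0; rewrite lexx ler01 /near_end; split => //; lra.
have Ww : wedgeW n (wpt : R * R) by rewrite z0; exact: gam_wedge.
have wP (l : 'I_n) (u : R) : 0 <= u <= 1 -> near_end m u -> exists u0 : R,
    [/\ 0 <= u0 <= 1, gam l u0 = wpt, `|u - u0| < m & near_wpt (gam l u)].
  move=> uI; rewrite /near_end => /orP ue.
  have nl : near_wpt (gam l u) by exists l, u; split => //; rewrite /near_end; lra.
  by case: ue => ue; [exists 0|exists 1]; split; rewrite ?gam0 ?gam1// ?ltr_norml; lra.
have [u [uI ku tu nk]] := wP k t tI te.
have [u' [u'I ku' t'u' nk']] := wP k' t' t'I t'e.
have b1 : ball (gam k t) r wpt by rewrite -ku; apply: sP; rewrite ?ballR//; exact: lt_le_trans tu _.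
have b2 : ball wpt r (gam k' t').
  by apply: ball_sym; rewrite -ku'; apply: sP; rewrite ?ballR//; exact: lt_le_trans t'u' _.
(* Both points are near the wedge point, perhaps on different circles or at opposite ends of one
   circle; flatness splits the comparison at [wpt] into two comparisons, each along one circle. *)
rewrite -(flr _ wpt)//; try exact: gam_wedge.
rewrite -{1}ku edge//; [|exact: lt_le_trans tu _|exact: lt_le_trans tu _].
rewrite -{1}ku' edge//; try by rewrite distrC; exact: lt_le_trans t'u' _.
by rewrite ku ku' vw !wedge_cocycle_near// invg1 !mulg1 mul1g.
Qed.

Lemma edge_primitives (c : R * R -> R * R -> G) : flat_on (@wedgeW R n) c ->
  {H : 'I_n -> R -> G & forall k, H k 0 = 1%g /\
    exists2 d : R, 0 < d & forall t t' : R, 0 <= t <= 1 -> 0 <= t' <= 1 ->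
    ball t d t' -> c (gam k t) (gam k t') = ((H k t)^-1 * H k t')%g}.
Proof.
move=> flc; apply: (@choice _ _ (fun k (Hk : R -> G) => Hk 0 = 1%g /\
    exists2 d : R, 0 < d & forall t t' : R, 0 <= t <= 1 -> 0 <= t' <= 1 ->
    ball t d t' -> c (gam k t) (gam k t') = ((Hk t)^-1 * Hk t')%g)) => k.
apply: (primitive (fun t t' => c (gam k t) (gam k t'))).
exact: (flat_comp _ _ _ _ (gam_ucont k) (fun t _ => gam_wedge k t) flc).
Qed.

Lemma flat_coh_wedge_ex (c : R * R -> R * R -> G) :
  flat_on (@wedgeW R n) c -> exists al, cohomologous (@wedgeW R n) c (wedge_cocycle al).
Proof.
move=> flc.
have [H HP] := edge_primitives _ flc.
by exists (fun k => H k 1); apply: flat_coh_wedge => // k; have [] := HP k.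
Qed.

(** On the interval of the j-th letter [k], both [H] and the step function along circle [k] are
    primitives of the same cocycle, so their quotient is constant and [H] gains the factor [al k] on
    the right. *)
Lemma traces_holonomy (f : R -> R * R) (w : seq 'I_n) al (H : R -> G) (d : R) :
  traces n f w -> H 0 = 1%g -> 0 < d ->
  (forall t t' : R, 0 <= t <= 1 -> 0 <= t' <= 1 -> ball t d t' ->
     wedge_cocycle al (f t) (f t') = ((H t)^-1 * H t')%g) ->
  H 1 = (\prod_(m <- w) al m)%g.
Proof.
move=> [s [s0 [s1 sP]]] H0 d0 HP.
have mono i j : (i <= j <= size w)%N -> s i <= s j.
  elim: j => [|j IHj]; first by rewrite leqn0 => /andP[/eqP ->].
  rewrite leq_eqVlt => /andP[/orP[/eqP -> //|ij] jw].
  by apply: le_trans (ltW (sP j jw).1); apply: IHj; rewrite -ltnS ij ltnW.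
have sI j : (j <= size w)%N -> 0 <= s j <= 1.
  by move=> jw; rewrite -s0 -s1 !mono ?jw ?leqnn.
suff HS j : (j <= size w)%N -> H (s j) = (\prod_(m <- take j w) al m)%g.
  by rewrite -s1 HS// take_size.
elim: j => [|j IHj] jw; first by rewrite s0 H0 take0 big_nil.
have [sjj [h [ch [hinc [h0 [h1 fh]]]]]] := sP j jw.
set k := tnth _ _ in fh; have wj : take j.+1 w = rcons (take j w) k.
  have kE : nth k w j = k by rewrite {2}/k (tnth_nth k).
  by rewrite (take_nth k)// kE.
rewrite wj -cats1 big_cat big_seq1/= -IHj; last exact: ltnW.
have hI u : s j <= u <= s j.+1 -> 0 <= h u <= 1.
  move=> uI; rewrite -h0 -h1; apply/andP; split.
    have := (andP uI).1; rewrite le_eqVlt => /orP[/eqP -> //|su].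
    by apply/ltW/hinc => //=; rewrite lexx ltW.
  have := (andP uI).2; rewrite le_eqVlt => /orP[/eqP -> //|su].
  by apply/ltW/hinc => //=; rewrite lexx ltW.
have cJ : compact [set u : R | s j <= u <= s j.+1].
  by have := @segment_compact R (s j) (s j.+1); rewrite set_itvE.
have e80 : 0 < 1 / 8 :> R by lra.
have [e e0 he] := compact_ucont _ _ cJ ch _ e80.
have sjI := sI j (ltnW jw); have sjI' := sI j.+1 jw.
have : (H (s j) * (edge_step al k (h (s j)))^-1)%g =
    (H (s j.+1) * (edge_step al k (h (s j.+1)))^-1)%g.
  apply: (@locally_constant R G (fun u => H u * (edge_step al k (h u))^-1)%g _ _
    (Num.min d e) (ltW sjj)); first by rewrite lt_min d0.
  move=> u u' uI u'I uu'.
  have uJ : 0 <= u <= 1 by lra.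
  have u'J : 0 <= u' <= 1 by lra.
  have := HP u u' uJ u'J (ball_minl _ _ _ _ uu').
  rewrite !fh// wedge_cocycle_gam ?hI//; last first.
    by have := he u u' uI u'I (ball_minr _ _ _ _ uu'); rewrite ballR.
  move=> E; apply: (mulgI (H u)^-1%g); rewrite mulKg mulgA -E.
  by rewrite mulgK.
by rewrite h0 h1 edge_step0 edge_step1 invg1 mulg1 => ->; rewrite mulgVK.
Qed.

(** Pulling back along [f] acts on holonomies by precomposition with the induced map on the
    fundamental group. *)
Lemma pi1_coh (f : R * R -> R * R) (w : 'I_n -> seq 'I_n) al :
  ucont_on (@wedgeW R n) f -> (forall z, wedgeW n z -> wedgeW n (f z)) -> pi1_is n f w ->
  cohomologous (@wedgeW R n) (fun z z' => wedge_cocycle al (f z) (f z'))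
    (wedge_cocycle (fun k => \prod_(m <- w k) al m)%g).
Proof.
move=> uf fW fw; set c := fun z z' => _.
have flc : flat_on (@wedgeW R n) c by exact: flat_comp uf fW (wedge_cocycle_flat al).
have [H HP] := edge_primitives _ flc.
have -> : (fun k => \prod_(m <- w k) al m)%g = (fun k => H k 1).
  apply/funext => k; have [H0 [d d0 dP]] := HP k.
  by rewrite (traces_holonomy _ _ _ _ _ (fw k) H0 d0 dP).
by apply: flat_coh_wedge => // k; have [] := HP k.
Qed.

(** Once around circle [k], the combination of both step functions with [v] is constant; comparing
    its two ends gives conjugation by [v wpt], the same element for every circle. *)
Lemma wedge_coh_conj al be :
  cohomologous (@wedgeW R n) (wedge_cocycle al) (wedge_cocycle be) ->
  exists u : G, forall k, al k = (be k ^ u)%g.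
Proof.
move=> [v [d d0 dP]]; exists (v wpt) => k.
have [e e0 eP] := gam_ucont k d d0.
have : (edge_step be k 0 * v (gam k (0 : R)) * (edge_step al k 0)^-1)%g =
    (edge_step be k 1 * v (gam k (1 : R)) * (edge_step al k 1)^-1)%g.
  apply: (@locally_constant R G
    (fun t => edge_step be k t * v (gam k t) * (edge_step al k t)^-1)%g
    0 1 (Num.min e (1 / 8))) => //; first by rewrite lt_min e0; lra.
  move=> t t' tI t'I tt'.
  have t8 : `|t - t'| < 1 / 8 by rewrite -ballR; exact: ball_minr tt'.
  have := dP _ _ (gam_wedge k t) (gam_wedge k t') (eP _ _ tI t'I (ball_minl _ _ _ _ tt')).
  rewrite !wedge_cocycle_gam// => E.
  apply: (mulIg (edge_step al k t')); rewrite mulgVK -mulgA E.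
  by rewrite !mulgA mulgK mulgV mul1g.
rewrite gam0 gam1 !edge_step0 !edge_step1 invg1 mulg1 mul1g => E.
by rewrite conjgE mulgA -[RHS]mulgA -(mulgVK (al k) (be k * _)%g) -E mulKg.
Qed.

End WedgeCocycle.

(** * Towers of wedges *)

Lemma wedge_cocycle_morph {R : realType} {n : nat} {G G' : groupType} (h : G -> G')
    (al : 'I_n -> G) (z z' : R * R) :
  {morph h : x y / (x * y)%g} -> {morph h : x / x^-1%g} -> h 1%g = 1%g ->
  h (wedge_cocycle al z z') = wedge_cocycle (h \o al) z z'.
Proof.
move=> hM hV h1; have side y : h (wedge_side al y) = wedge_side (h \o al) y.
  by rewrite /wedge_side; case: pickP.
by rewrite /wedge_cocycle; case: ifP => // _; rewrite hM hV !side.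
Qed.

Lemma prod_posw {n : nat} (al : 'I_n -> free_group n) (w : 'I_n -> seq 'I_n) k :
  (\prod_(m <- w k) al m)%g = fghom al (fgof (posw w k)).
Proof. by rewrite /fghom word_eval_freduce /word_eval big_map. Qed.

(** What is kept of an expansion once flow and base point are forgotten; in this form it can be
    transported along a homeomorphism. *)
Definition wedge_tower {R : realType} (n : nat) {X : pseudoMetricType R}
    (f : nat -> R * R -> R * R) (p : nat -> X -> R * R) :=
  [/\ forall i, ucont_on (@wedgeW R n) (f i), forall i z, wedgeW n z -> wedgeW n (f i z),
      forall i, continuous (p i), forall i, range (p i) = wedgeW n &
      (forall i x, p i x = f i (p i.+1 x)) /\ (forall x y, (forall i, p i x = p i y) -> x = y)].

Lemma expansion_tower {R : realType} {n : nat} {X : topologicalType} {Z : pseudoMetricType R}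
    (phi : R -> X -> X) (x0 : X) f p (h : Z -> X) (h' : X -> Z) :
  expansion n phi x0 f p -> continuous h -> cancel h h' -> cancel h' h ->
  wedge_tower n f (fun i => p i \o h).
Proof.
move=> [fP [pP [pf [_ [Pinj _]]]]] ch hK h'K; split.
- by move=> i; apply: compact_ucont; [exact: wedge_compact|have [] := fP i].
- by move=> i z Wz; have [_ [fW _]] := fP i; rewrite -fW; exists z.
- by move=> i x; apply: continuous_comp; [exact: ch|apply: (pP i).1].
- move=> i; rewrite -(pP i).2.1; apply/seteqP; split => z [x _ <-]; first by exists (h x).
  by exists (h' x); rewrite //= h'K.
split=> [i x|x y xy]; first exact: pf.
by apply: (can_inj hK); apply: Pinj; apply/funext.
Qed.

Section Towers.
Context {R : realType} {n : nat} {X : pseudoMetricType R}.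
Variables (f : nat -> R * R -> R * R) (p : nat -> X -> R * R).
Hypotheses (cX : compact [set: X]) (fp : wedge_tower n f p).

Lemma tower_ucont i : ucont_on setT (p i).
Proof.
by apply: compact_ucont => //; apply: continuous_subspaceT; have [_ _ cp _ _] := fp; exact: cp.
Qed.

Lemma tower_wedge i x : wedgeW n (p i x).
Proof. by have [_ _ _ rp _] := fp; rewrite -(rp i); exists x. Qed.

Lemma tower_section (x0 : X) i :
  {s : R * R -> X & forall u, wedgeW n u -> p i (s u) = u}.
Proof.
have [_ _ _ rp _] := fp.
apply: (@choice _ _ (fun u x => wedgeW n u -> p i x = u)) => u.
(* Off the wedge the section takes the default value [x0]. *)
have [Wu|nW] := pselect (wedgeW n u); last by exists x0.
by have := Wu; rewrite -(rp i) => -[x _ xu]; exists x.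
Qed.

Lemma tower_close (e : R) : 0 < e -> exists J, forall j, (J <= j)%N ->
  exists2 d : R, 0 < d & forall x y, ball (p j x) d (p j y) -> ball x e y.
Proof.
have [_ _ cp _ [pf sep]] := fp; move=> e0.
have hRR : hausdorff_space (R * R)%type by exact: norm_hausdorff.
exact: (tower_small p f hRR cX cp pf sep e e0).
Qed.

(** At a stage whose fibres are smaller than the flatness radius, the cocycle descends along a
    section to a flat cocycle on the wedge, where holonomy classifies it. *)
Lemma tower_coh (x0 : X) {G : groupType} (c : X -> X -> G) : flat_on setT c ->
  exists J, forall j, (J <= j)%N -> exists al : 'I_n -> G,
    cohomologous setT c (fun x y => wedge_cocycle al (p j x) (p j y)).
Proof.
move=> [d d0 cP]; have [J JP] := tower_close d d0; exists J => j /JP[e e0 small].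
have [s sP] := tower_section x0 j.
have flc : flat_on (@wedgeW R n) (fun u v => c (s u) (s v)).
  by exists e => // u v w Wu Wv Ww uv vw uw; apply: cP => //; apply: small; rewrite !sP.
have [al alP] := flat_coh_wedge_ex _ flc; exists al.
apply: (coh_trans _ _ _ _ (flat_section _ _ _ c d e (tower_ucont j) e0 (tower_wedge j) sP small _)).
  by move=> x y z; exact: cP.
exact: coh_comp (tower_ucont j) (fun x _ => tower_wedge j x) alP.
Qed.

Fixpoint bonding k m (z : R * R) : R * R :=
  if m is m'.+1 then bonding k m' (f (k + m') z) else z.

Lemma bonding_tower k m x : p k x = bonding k m (p (k + m)%N x).
Proof.
have [_ _ _ _ [pf _]] := fp; elim: m => [|m IHm] /=; first by rewrite addn0.
by rewrite addnS -pf.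
Qed.

(** Here [ga] is the automorphism induced by the composite map from stage [k + m] to stage [k]. It
    is independent of the coefficients [al]. *)
Lemma bonding_coh k m :
  (forall i, exists w, pi1_is n (f i) w /\ is_aut (posw w)) ->
  exists ga : 'I_n -> free_group n, bijective (fghom ga) /\
    forall al : 'I_n -> free_group n, cohomologous (@wedgeW R n)
      (fun z z' => wedge_cocycle al (bonding k m z) (bonding k m z'))
      (wedge_cocycle (fghom al \o ga)).
Proof.
move=> faut; have [uf fW _ _ _] := fp; elim: m => [|m [ga [gab gaP]]].
  exists fggen; split; first by exists id => x; rewrite fghom_gen.
  move=> al; apply: eq_coh => z z' _ _ /=; congr wedge_cocycle.
  by apply/funext => l; rewrite /= /fghom word_eval_fggen.
have [w [fw /is_autP wb]] := faut (k + m)%N.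
exists (fghom ga \o (fun l => fgof (posw w l))); split.
  by apply: (eq_bij (bij_comp gab wb)); exact: fghom_comp.
move=> al; have := coh_comp _ _ _ _ _ (uf (k + m)%N) (fW (k + m)%N) (gaP al).
move=> /coh_trans; apply; apply: (coh_trans _ _ _ _ (pi1_coh _ _ _ (uf _) (fW _) fw)).
apply: eq_coh => z z' _ _; congr wedge_cocycle; apply/funext => l.
by rewrite prod_posw -fghom_comp.
Qed.

End Towers.

Lemma flat_pullback {R : realType} {n : nat} {X : pseudoMetricType R} {G : groupType} f
    (p : nat -> X -> R * R) (al : 'I_n -> G) j :
  compact [set: X] -> wedge_tower n f p ->
  flat_on [set: X] (fun x y => wedge_cocycle al (p j x) (p j y)).
Proof.
move=> cX fp; apply: (flat_comp _ (@wedgeW R n) (p j)); last exact: wedge_cocycle_flat.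
  exact: (tower_ucont f p cX fp).
by move=> x _; exact: (tower_wedge f p fp).
Qed.

(** * Comparison of two towers on one space *)

Section TwoTowers.
Context {R : realType} {n : nat} {X : pseudoMetricType R}.
Variables (x0 : X) (f g : nat -> R * R -> R * R) (p q : nat -> X -> R * R).
Hypotheses (cX : compact [set: X]) (fp : wedge_tower n f p) (gq : wedge_tower n g q).
Hypothesis faut : forall i, exists w, pi1_is n (f i) w /\ is_aut (posw w).

Lemma comparison_bij (a : 'I_n -> free_group n) j :
  cohomologous setT (fun x y => wedge_cocycle fggen (p 0%N x) (p 0%N y))
    (fun x y => wedge_cocycle a (q j x) (q j y)) ->
  bijective (fghom a).
Proof.
(* The tautological cocycle of stage [j] of the second tower is expressed through a far stage [k] of
   the first by [b]; applying [fghom a] to the coefficients then yields the composite of [a] and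
   [b]. *)
move=> pq; have [k /(_ k (leqnn k)) [b bP]] :=
  tower_coh f p cX fp x0 _ (flat_pullback g q fggen j cX gq).
have aM : {morph fghom a : x y / (x * y)%g} by move=> x y; exact: word_evalM.
have aV : {morph fghom a : x / x^-1%g} by move=> x; exact: word_evalV.
have a1 : fghom a 1%g = 1%g by exact: word_eval1.
have agen : fghom a \o fggen = a.
  by apply/funext => l; rewrite /= /fghom word_eval_fggen.
have [be [beb beP]] := bonding_coh f p fp 0 k faut.
have {bP} := coh_morph _ _ _ _ aM aV bP.
rewrite (_ : (fun x y => fghom a _) = fun x y => wedge_cocycle a (q j x) (q j y)); last first.
  by apply/funext => x; apply/funext => y; rewrite wedge_cocycle_morph// agen.
rewrite (_ : (fun x y => fghom a _) =
    fun x y => wedge_cocycle (fghom a \o b) (p k x) (p k y)); last first.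
  by apply/funext => x; apply/funext => y; rewrite wedge_cocycle_morph.
move=> /(coh_trans _ _ _ _ pq) pa.
have := coh_comp _ _ _ _ _ (tower_ucont f p cX fp k) (fun x _ => tower_wedge f p fp k x) (beP fggen).
rewrite (_ : (fun x y => wedge_cocycle fggen _ _) =
    fun x y => wedge_cocycle fggen (p 0%N x) (p 0%N y)); last first.
  by apply/funext => x; apply/funext => y; rewrite -!(bonding_tower f p fp).
have -> : fghom fggen \o be = be by apply/funext => l; rewrite /= fghom_gen.
(* The composite of [a] and [b] and the bonding automorphism [be] now give cohomologous cocycles,
   but only on [X]. A stage [k + J] with small fibres lets the transfer function [v] descend to the
   wedge along a section, at the price of pulling both cocycles back by the bonding map, whence
   [ga]. *)
move=> pb; have [v [e e0 vP]] := coh_trans _ _ _ _ (coh_sym _ _ _ pa) pb.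
have [J JP] := tower_close f p cX fp e e0.
have [d d0 small] := JP (k + J)%N (leq_addl _ _).
have [s sP] := tower_section f p fp x0 (k + J)%N.
have [ga [[ga' _ gaK] gaP]] := bonding_coh f p fp k J faut.
have pk u : wedgeW n u -> p k (s u) = bonding f k J u.
  by move=> Wu; rewrite (bonding_tower f p fp k J) sP.
have ab : cohomologous (@wedgeW R n)
    (fun z z' => wedge_cocycle (fghom a \o b) (bonding f k J z) (bonding f k J z'))
    (fun z z' => wedge_cocycle be (bonding f k J z) (bonding f k J z')).
  exists (v \o s), d => // x y Wx Wy xy; rewrite -!pk//=.
  by apply: vP => //; apply: small; rewrite !sP.
have [u uP] := wedge_coh_conj _ _
  (coh_trans _ _ _ _ (coh_sym _ _ _ (gaP _)) (coh_trans _ _ _ _ ab (gaP _))).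
have [be' _ beK] := beb.
apply: (fghom_bij_of_conj n a b be ga u) uP => y; first by exists (be' y).
by exists (ga' y).
Qed.

Lemma bonding_aut_eventually : exists J, forall j, (J <= j)%N ->
  forall w, pi1_is n (g j) w -> is_aut (posw w).
Proof.
have [J JP] := tower_coh g q cX gq x0 _ (flat_pullback f p fggen 0%N cX fp).
exists J => j /JP[a aP] w gw; have [ug gW _ _ [qg _]] := gq.
have ab := comparison_bij _ _ aP.
(* Pulling the stage [j] cocycle back through [g j] gives the comparison map at stage [j.+1] as [a]
   after the map induced by [g j]; both comparison maps are bijective, so [a] can be cancelled. *)
have := coh_comp _ _ _ _ _ (tower_ucont g q cX gq j.+1)
  (fun x _ => tower_wedge g q gq j.+1 x) (pi1_coh _ _ a (ug j) (gW j) gw).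
rewrite (_ : (fun x y => wedge_cocycle a _ _) =
    fun x y => wedge_cocycle a (q j x) (q j y)); last first.
  by apply/funext => x; apply/funext => y; rewrite -!qg.
move=> /(coh_trans _ _ _ _ aP)/comparison_bij wb; apply/is_autP.
have {}wb : bijective (fghom a \o fghom (fun l => fgof (posw w l))).
  apply: (eq_bij wb) => x; rewrite fghom_comp; congr fghom; apply/funext => l.
  by rewrite prod_posw.
have [a' aK a'K] := ab.
apply: (eq_bij (bij_comp (Bijective a'K aK) wb)) => x /=.
by rewrite aK.
Qed.

End TwoTowers.

Theorem theorem8p3 (R : realType) (n : nat)
  (X : pseudoMetricType R) (phi : R -> X -> X) (x0 : X)
  (f : nat -> R * R -> R * R) (p : nat -> X -> R * R)
  (Y : pseudoMetricType R) (psi : R -> Y -> Y) (y0 : Y)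
  (g : nat -> R * R -> R * R) (q : nat -> Y -> R * R) :
  flow_space phi -> minimal_flow phi -> aperiodic_flow phi ->
  expansion n phi x0 f p ->
  flow_space psi -> minimal_flow psi -> aperiodic_flow psi ->
  expansion n psi y0 g q ->
  (forall i, exists w, pi1_is n (f i) w /\ is_aut (posw w)) ->
  (forall i, exists j, (i < j)%N /\
     exists w, pi1_is n (g j) w /\ ~ is_aut (posw w)) ->
  ~ flow_equiv phi psi.
Proof.
move=> [cX _] _ _ Xf _ _ _ Yg faut gnaut [h [h' [ch [ch' [hK [h'K _]]]]]].
(* Both towers are read on [X]: the first through the identity, the second through the homeomorphism
   [h]. *)
have fp : wedge_tower n f p.
  by apply: (expansion_tower phi x0 f p id id Xf) => // x; exact: cvg_id.
have gq := expansion_tower psi y0 g q h h' Yg ch hK h'K.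
have [J JP] := bonding_aut_eventually x0 f g p _ cX fp gq faut.
by have [j [Jj [w [gw []]]]] := gnaut J; apply: (JP j (ltnW Jj) w gw).
Qed.
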